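(* Let $a,b,c>0$ and for $\mathbf{x}=(x,y)\in\overline{\mathbb{R}_+^2}$, $t>0$ let $$\varphi^*(\mathbf{x},t)=\min_{s\ge0}\left\{\frac{(-x+bs+ct)^2}{4(t+as)}+\frac{(y+s)^2}{4t}\right\}.$$ For any $(\mathbf{x},t)\in\overline{\mathbb{R}_+^2}\times\mathbb{R}_+$ there exists a unique $s^*=s^*(\mathbf{x},t)\ge0$ satisfying $$\varphi^*(\mathbf{x},t)=\frac{(-x+bs^*+ct)^2}{4(t+as^* )}+\frac{(y+s^* )^2}{4t}.$$ Moreover: 1. $s^*=0$ if and only if $(\mathbf{x},t)\in S_0:=\{(\mathbf{x},t)\in\overline{\mathbb{R}_+^2}\times\mathbb{R}_+:\ y\ge\frac{a}{2t}(x-ct)^2+b(x-ct)\}$. For $(\mathbf{x},t)\in S:=(\overline{\mathbb{R}_+^2}\times\mathbb{R}_+)\setminus S_0$, $s^*$ satisfies the equation $$2(y+s^* )(t+as^* )^2=ax^2t-2(ac-b)xt^2+c(ac-2b)t^3.$$ 2. $\varphi^*(\mathbf{x},t)$ is $C^\infty$-smooth in $S_0\cap(\overline{\mathbb{R}_+^2}\times\mathbb{R}_+)$ and in $S\cap(\overline{\mathbb{R}_+^2}\times\mathbb{R}_+)$, and is $C^1$-smooth throughout $\overline{\mathbb{R}_+^2}\times\mathbb{R}_+$. 3. $\varphi^*$ and $s^*$ are homogeneous of degree one in the variable $t$, i.e. $\varphi^*(t\mathbf{x},t)=t\,\varphi^*(\mathbf{x},1)$ and $s^*(t\mathbf{x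},t)=t\,s^*(\mathbf{x},1)$.
   Context: $\mathbb{R}_+=(0,\infty)$ and $\overline{\mathbb{R}_+^2}=\mathbb{R}\times[0,\infty)$; $\mathbf{x}=(x,y)$.
   Formalization: The equation for s* on S is false as printed (a=b=c=t=1, (x,y)=(3,0) gives s=1, not the minimiser); the formal statement subtracts the missing term b^2 t s*(2t+as* ) from its right-hand side. *)

(* Defs.v *)
From mathcomp Require Import all_boot all_order all_algebra.
From mathcomp Require Import all_classical all_reals all_analysis.
Import Order.TTheory GRing.Theory Num.Theory.
Import numFieldNormedType.Exports.

Set Implicit Arguments.
Unset Strict Implicit.
Unset Printing Implicit Defensive.

Local Open Scope classical_set_scope.
Local Open Scope ring_scope.

Section Smoothness.
Context {R : realType} {V : normedModType R}.

(* Meaningful for open U only.  The direction v ranges over all of V, so for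
   finite-dimensional V this says that all partial derivatives of order at most
   k exist and are continuous on U. *)
Fixpoint Ck (k : nat) (U : set V) (f : V -> R) : Prop :=
  match k with
  | 0%N => forall p, U p -> {for p, continuous f}
  | k'.+1 => (forall p, U p -> differentiable f p) /\
             forall v : V, Ck k' U ('D_v f)
  end.

Definition Cinfty (U : set V) (f : V -> R) : Prop := forall k, Ck k U f.

(* Smoothness on a set D that need not be open: near each of its points, f
   coincides on D with a function that is smooth on an open neighbourhood in the
   whole space.  The value of f outside D plays no role. *)
Definition smooth_on (P : set V -> (V -> R) -> Prop) (D : set V)
    (f : V -> R) : Prop :=
  forall p, D p -> exists (U : set V) (g : V -> R),
    [/\ open U, U p, P U g & forall q, U q -> D q -> g q = f q].

Definition Ck_on (k : nat) := smooth_on (Ck k).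
Definition Cinfty_on := smooth_on Cinfty.

End Smoothness.

Section Phi.
Context {R : realType}.
Implicit Types (a b c t s : R) (x : R * R).

Definition closed_half_plane : set (R * R) := [set x | 0 <= x.2].

Definition Rplus : set R := [set t | 0 < t].

Definition space_time : set (R * R * R) := closed_half_plane `*` Rplus.

Definition Phi a b c x t s : R :=
  (- x.1 + b * s + c * t) ^+ 2 / (4 * (t + a * s))
  + (x.2 + s) ^+ 2 / (4 * t).

(* An infimum of nonnegative reals when a >= 0 and t > 0; it is a minimum
   exactly when is_sstar below has a solution. *)
Definition phistar a b c x t : R :=
  inf [set Phi a b c x t s | s in [set s | 0 <= s]].

Definition is_sstar a b c x t s : Prop :=
  0 <= s /\ phistar a b c x t = Phi a b c x t s.

(* A choice of s with is_sstar, and 0 if there is none. *)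
Definition sstar a b c x t : R := xget 0 [set s | is_sstar a b c x t s].

Definition region_S0 a b c : set (R * R * R) :=
  space_time `&`
  [set p | let: (x, t) := p in
     x.2 >= a / (2 * t) * (x.1 - c * t) ^+ 2 + b * (x.1 - c * t)].

Definition region_S a b c : set (R * R * R) :=
  space_time `\` region_S0 a b c.

End Phi.

(* Main.v *)
Require Import Defs.
From HB Require Import structures.
From mathcomp Require Import all_boot all_order all_algebra.
From mathcomp Require Import all_classical all_reals all_analysis.
From mathcomp Require Import ring lra.
Import Order.TTheory GRing.Theory Num.Theory.
Import numFieldNormedType.Exports.
Local Open Scope classical_set_scope.
Local Open Scope ring_scope.

(** Put [u = t + a s] and [m = b t + a (x - c t)].  Since
    [b s - x + c t = (b u - m) / a], the function minimised is, up to terms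
    affine in [s], the sum of [m^2 / (4 a^2 u)] and [(y + s)^2 / (4 t)]: it is
    strictly convex in [s >= 0].  Its derivative in [s], multiplied by [4 a t],
    is the strictly increasing function
    [slope = b^2 t - m^2 t / u^2 + 2 a (y + s)], so that the minimiser [s*] is
    characterised by the optimality conditions of Karush, Kuhn and Tucker:
    [s >= 0], [slope >= 0], [s * slope = 0] ([is_sstarP]).  Existence is the
    intermediate value theorem for [slope] and uniqueness is strict convexity.
    Hence [s* = 0] exactly when [slope >= 0] at [s = 0], an inequality which
    rearranges to the definition of [S_0]; otherwise [slope] vanishes at [s*],
    which is the stated equation once the denominator [u^2] is cleared.

    All of this holds for every real [y] as soon as [t > 0], so the minimum
    [phi*] itself provides the smooth extensions across [y = 0] which the
    second part requires.
    - On [S_0], [phi*] is the rational function obtained for [s = 0].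
    - On the open set where [slope < 0] at [s = 0], the equation [slope = 0]
      determines [s*], and [slope] has a positive derivative in [s].  The
      gradient of [s*] is therefore a rational function of the point and of
      [s*], without poles, and a bootstrap shows that [s*], hence [phi*], is
      smooth ([sstar_smooth]).
    - Everywhere, [s*] is continuous ([sstar_continuous]) and [phi*] satisfies
      the envelope theorem: its gradient is the gradient of the minimised
      function in [(x, y, t)] at [s = s*] ([phistar_derive]), which is
      continuous.

    Both differentiability statements rest on [squeeze_differentiable]: an
    increment [f q - f p] that lies between two expressions [A q . (q - p)] and
    [B q . (q - p)], where [A] and [B] are continuous at [p] and agree there,
    makes [f] differentiable at [p] with gradient [A p].  The vectors [A] and
    [B] come from exact factorisations of the increments of the rational
    functions at hand ([slope_increment], [Phi_increment]).

    Homogeneity holds because the minimised function and [slope] are both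
    homogeneous of degree one in [(x, y, t, s)]. *)

Set Implicit Arguments.
Unset Strict Implicit.

(** * Calculus of functions of class Ck *)

Section CkAlgebra.
Context {R : realType} {V : normedModType R}.
Implicit Types (U : set V) (f g : V -> R).

Lemma near_open_eq U f g p : open U -> (forall q, U q -> f q = g q) -> U p ->
  \forall q \near p, f q = g q.
Proof.
move=> oU fg Up; apply: filterS (open_nbhs_nbhs (conj oU Up)).
exact: fg.
Qed.

Lemma littleo_shiftP f p (L : V -> R) :
  f \o shift p = cst (f p) + L +o_ 0 id <->
  forall e, 0 < e -> \forall q \near p,
    `|f q - f p - L (q - p)| <= e * `|q - p|.
Proof.
rewrite eqaddoP; split=> fL e e0; have := fL e e0.
  rewrite [\forall x \near _, _ <= _](near_shift p) sub0r.
  by apply: filterS => q; rewrite /= !fctE /= subrK opprD addrA.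
rewrite [X in _ -> X](near_shift p) sub0r.
by apply: filterS => q; rewrite /= !fctE /= subrK opprD addrA.
Qed.

Lemma differentiable_of_littleo f p (L : {linear V -> R}) : continuous L ->
  (forall e, 0 < e -> \forall q \near p,
     `|f q - f p - L (q - p)| <= e * `|q - p|) ->
  differentiable f p /\ ('d f p = L :> (V -> R)).
Proof.
move=> cL /littleo_shiftP fL; have dL := diff_unique cL fL.
by split=> //; apply/diff_locallyP; rewrite dL.
Qed.

Lemma Ck_eq U f g k : open U -> (forall q, U q -> f q = g q) ->
  Ck k U f -> Ck k U g.
Proof.
move=> oU; elim: k f g => [|k IH] f g fg /=.
  move=> cf p Up; rewrite /prop_for /continuous_at -fg//.
  have fgp := near_open_eq oU fg Up.
  apply: cvg_trans (cf p Up); apply: near_eq_cvg; exact: fgp.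
move=> [df Df]; split=> [p Up|v].
  have fgp := near_open_eq oU fg Up.
  have cd : continuous ('d f p) by apply: diff_continuous; exact: df.
  have [] // := differentiable_of_littleo (L := 'd f p) (f := g) (p := p).
  move=> e e0; near=> q.
  have -> : g q = f q by apply/esym; near: q; exact: fgp.
  rewrite -(fg p Up); near: q.
  exact: (littleo_shiftP f p ('d f p)).1 (diff_locally (df p Up)) e e0.
apply: IH (Df v) => q Uq; apply: near_eq_derive; exact: near_open_eq oU fg Uq.
Unshelve. all: by end_near. Qed.

Lemma Ck_pred k U f : Ck k.+1 U f -> Ck k U f.
Proof.
elim: k f => [|k IH] f [df Df] /=.
  by move=> p Up; apply: differentiable_continuous; apply: df.
by split=> // v; apply: IH; apply: Df.
Qed.

Lemma Ck_cst k U (r : R) : open U -> Ck k U (fun _ => r).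
Proof.
move=> oU; elim: k r => [|k IH] r /=.
  by move=> p _; exact: cvg_cst.
split=> [p _|v]; first exact: differentiable_cst.
apply: Ck_eq (IH 0) => // q _; exact/esym/derive_cst.
Qed.

Lemma Ck_add k U f g : open U -> Ck k U f -> Ck k U g ->
  Ck k U (fun p => f p + g p).
Proof.
move=> oU; elim: k f g => [|k IH] f g /=.
  by move=> cf cg p Up; apply: continuousD; [exact: cf|exact: cg].
move=> [df Df] [dg Dg]; split=> [p Up|v].
  by apply: differentiableD; [exact: df|exact: dg].
apply: Ck_eq (IH _ _ (Df v) (Dg v)) => // q Uq.
by rewrite deriveD //; apply: diff_derivable; [exact: df|exact: dg].
Qed.

Lemma Ck_mul k U f g : open U -> Ck k U f -> Ck k U g ->
  Ck k U (fun p => f p * g p).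
Proof.
move=> oU; elim: k f g => [|k IH] f g.
  by move=> cf cg p Up; apply: continuousM; [exact: cf|exact: cg].
move=> Cf Cg; have [df Df] := Cf; have [dg Dg] := Cg; split=> [p Up|v].
  by apply: differentiableM; [exact: df|exact: dg].
have := Ck_add oU (IH _ _ (Ck_pred Cf) (Dg v)) (IH _ _ (Ck_pred Cg) (Df v)).
apply: Ck_eq => // q Uq.
by rewrite deriveM //; apply: diff_derivable; [exact: df|exact: dg].
Qed.

Lemma Ck_opp k U f : open U -> Ck k U f -> Ck k U (fun p => - f p).
Proof.
move=> oU Cf; apply: Ck_eq (Ck_mul oU (Ck_cst k (-1) oU) Cf) => // q _.
by rewrite mulN1r.
Qed.

(** The derivative of [1 / f] is [- f' / f^2], which involves [1 / f] itself:
    the regularity of [1 / f] is gained one order at a time. *)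
Lemma Ck_inv k U f : open U -> (forall p, U p -> f p != 0) -> Ck k U f ->
  Ck k U (fun p => (f p)^-1).
Proof.
move=> oU f0; elim: k => [|k IH] Cf.
  by move=> p Up; apply: continuousV; [exact: f0|exact: Cf].
have [df Df] := Cf; split=> [p Up|v].
  by apply: differentiableV; [exact: df|exact: f0].
have CV := IH (Ck_pred Cf).
have := Ck_opp oU (Ck_mul oU (Ck_mul oU CV CV) (Df v)).
apply: Ck_eq => // q Uq.
rewrite deriveV; [|exact: f0|by apply: diff_derivable; exact: df].
by rewrite /GRing.scale /= expr2 invfM mulNr.
Qed.

Lemma Ck_linear k U (f : {linear V -> R}) : open U -> continuous f -> Ck k U f.
Proof.
move=> oU cf; case: k => [|k]; first by move=> p _; exact: cf.
have df p : differentiable f p by exact: linear_differentiable.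
split=> // v; apply: Ck_eq (Ck_cst k (f v) oU) => // q _.
by rewrite deriveE// diff_lin.
Qed.

Lemma Ck_exp k U f n : open U -> Ck k U f -> Ck k U (fun p => f p ^+ n).
Proof.
move=> oU Cf; elim: n => [|n IH]; first exact: Ck_cst.
apply: Ck_eq (Ck_mul oU Cf IH) => // p _; exact/esym/exprS.
Qed.

End CkAlgebra.

(** * Functions of a point of space-time *)

Section Gradient.
Context {R : realType}.
Implicit Types (p q l v : R * R * R) (f : R * R * R -> R).
Implicit Types (U : set (R * R * R)) (L : R * R * R -> R * R * R).

Definition dot l v : R := l.1.1 * v.1.1 + l.1.2 * v.1.2 + l.2 * v.2.

Lemma dot_linear l : linear_for *%R (dot l).
Proof. by move=> k v w; rewrite /dot /= /GRing.scale /=; ring. Qed.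

HB.instance Definition _ l :=
  GRing.isLinear.Build R (R * R * R)%type R *%R (dot l) (dot_linear l).

Lemma dotBl l l' v : dot (l - l') v = dot l v - dot l' v.
Proof. by rewrite /dot /=; ring. Qed.

Lemma dotZl k l v : dot (k *: l) v = k * dot l v.
Proof. by rewrite /dot /= /GRing.scale /=; ring. Qed.

Lemma ler_norm_dot l v : `|dot l v| <= 3 * `|l| * `|v|.
Proof.
have le1 (w : R * R * R) : `|w.1.1| <= `|w|.
  by rewrite !prod_normE !le_max lexx.
have le2 (w : R * R * R) : `|w.1.2| <= `|w|.
  by rewrite !prod_normE !le_max lexx orbT.
have le3 (w : R * R * R) : `|w.2| <= `|w|.
  by rewrite !prod_normE !le_max lexx orbT.
have -> : 3 * `|l| * `|v| = `|l| * `|v| + `|l| * `|v| + `|l| * `|v| by ring.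
rewrite /dot; apply: le_trans (ler_normD _ _) _; apply: lerD.
  by apply: le_trans (ler_normD _ _) _; apply: lerD; rewrite normrM ler_pM.
by rewrite normrM ler_pM.
Qed.

Lemma dot_continuous l : continuous (dot l).
Proof.
move=> v; have c1 : continuous (fun w : R * R * R => w.1.1).
  by move=> w; apply: continuous_comp; exact: cvg_fst.
have c2 : continuous (fun w : R * R * R => w.1.2).
  by move=> w; apply: continuous_comp; [exact: cvg_fst|exact: cvg_snd].
have c3 : continuous (fun w : R * R * R => w.2).
  by move=> w; exact: cvg_snd.
apply: (@continuousD _ _ _ (fun w => l.1.1 * w.1.1 + l.1.2 * w.1.2)
  (fun w => l.2 * w.2)); last exact: cvgMr (c3 v).
apply: (@continuousD _ _ _ (fun w => l.1.1 * w.1.1) (fun w => l.1.2 * w.1.2)).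
  exact: cvgMr (c1 v).
exact: cvgMr (c2 v).
Qed.

(** Caratheodory's criterion of differentiability, in a two-sided version: the
    error [f q - f p - A p . (q - p)] is at most the larger of
    [|A q - A p| |q - p|] and [|B q - B p| |q - p|], up to a constant.  With
    [A = B] it differentiates implicit functions; with the two sides distinct
    it differentiates a minimum over a parameter, bounded on either side by
    freezing the parameter at one of its two optimal values. *)
Lemma squeeze_differentiable f p (A B : R * R * R -> R * R * R) :
  {for p, continuous A} -> {for p, continuous B} -> A p = B p ->
  (\forall q \near p,
     dot (A q) (q - p) <= f q - f p <= dot (B q) (q - p)) ->
  differentiable f p /\ forall v, 'D_v f p = dot (A p) v.
Proof.
move=> cA cB AB fAB.
have [df dE] : differentiable f p /\ ('d f p = dot (A p) :> (_ -> _)).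
  apply: differentiable_of_littleo; first exact: dot_continuous.
  move=> e e0; have e3 : 0 < e / 3 by rewrite divr_gt0.
  near=> q.
  have A3 : `|A q - A p| <= e / 3.
    by rewrite distrC; near: q; exact: cvgr_dist_le cA _ e3.
  have B3 : `|B q - A p| <= e / 3.
    by rewrite distrC AB; near: q; exact: cvgr_dist_le cB _ e3.
  have dle l : `|l| <= e / 3 -> `|dot l (q - p)| <= e * `|q - p|.
    move=> l3; apply: le_trans (ler_norm_dot _ _) _.
    by apply: ler_wpM2r => //; rewrite -ler_pdivlMl// mulrC.
  have /andP[fA fB] : dot (A q) (q - p) <= f q - f p <= dot (B q) (q - p).
    by near: q.
  have := dle _ A3; have := dle _ B3.
  by rewrite !dotBl !ler_norml => /andP[_ ?] /andP[? _]; apply/andP; split; lra.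
by split=> // v; rewrite deriveE// dE.
Unshelve. all: by end_near. Qed.

Definition Ck3 k U (L : R * R * R -> R * R * R) : Prop :=
  [/\ Ck k U (fun p => (L p).1.1), Ck k U (fun p => (L p).1.2)
    & Ck k U (fun p => (L p).2)].

Lemma Ck_dot k U L v : open U -> Ck3 k U L -> Ck k U (fun p => dot (L p) v).
Proof.
by move=> oU [C1 C2 C3]; rewrite /dot; do 2?[apply: Ck_add => //];
  apply: Ck_mul => //; exact: Ck_cst.
Qed.

Lemma Ck_x k U : open U -> Ck k U (fun p => p.1.1).
Proof.
move=> oU; apply: Ck_eq (Ck_linear k oU (@dot_continuous (1, 0, 0))) => // p _.
by rewrite /= /dot /= !(mul0r, mul1r, addr0, add0r).
Qed.

Lemma Ck_y k U : open U -> Ck k U (fun p => p.1.2).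
Proof.
move=> oU; apply: Ck_eq (Ck_linear k oU (@dot_continuous (0, 1, 0))) => // p _.
by rewrite /= /dot /= !(mul0r, mul1r, addr0, add0r).
Qed.

Lemma Ck_t k U : open U -> Ck k U (fun p => p.2).
Proof.
move=> oU; apply: Ck_eq (Ck_linear k oU (@dot_continuous (0, 0, 1))) => // p _.
by rewrite /= /dot /= !(mul0r, mul1r, addr0, add0r).
Qed.

Lemma Ck3_cst k U p : open U -> Ck3 k U (fun _ => p).
Proof. by move=> oU; split; exact: Ck_cst. Qed.

Lemma Ck3_id k U : open U -> Ck3 k U id.
Proof. by move=> oU; split; [exact: Ck_x|exact: Ck_y|exact: Ck_t]. Qed.

Lemma Ck3_continuous U L p : Ck3 0 U L -> U p -> {for p, continuous L}.
Proof.
move=> [c1 c2 c3] Up.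
have -> : L = fun q => ((L q).1.1, (L q).1.2, (L q).2).
  by apply/funext => q; case: (L q) => [[]].
exact: (cvg_pair (cvg_pair (c1 p Up) (c2 p Up)) (c3 p Up)).
Qed.

End Gradient.

Local Arguments Ck : simpl never.

(** Regularity of a rational expression by structural recursion.  The context
    must contain the regularity of the atoms; what remains are the proofs that
    the denominators do not vanish.  The head symbol of the expression is read
    off its value at [0], where no binder is in the way. *)
Ltac Ck_tac :=
  repeat lazymatch goal with
  | |- open _ => assumption
  | |- @Ck _ ?V _ _ ?F =>
    let e := eval cbv beta in (F (0 : V)) in
    lazymatch e with
    | @GRing.exp _ _ _ => apply: Ck_exp
    | @GRing.add _ _ _ => apply: Ck_add
    | @GRing.mul _ _ _ => apply: Ck_mul
    | @GRing.opp _ _ => apply: Ck_opp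
    | @GRing.inv _ _ => apply: Ck_inv
    | _ => first [exact: Ck_cst | exact: Ck_x | exact: Ck_y | exact: Ck_t
      | assumption]
    end
  end.

(** * The minimiser and its optimality conditions *)

Section Minimizer.
Context {R : realType} (a b c : R) (a_gt0 : 0 < a).
Implicit Types (p q : R * R * R) (s : R).

(** The quantity [u] of the introduction. *)
Definition clock p s : R := p.2 + a * s.

(** The quantity [m] of the introduction. *)
Definition offset p : R := b * p.2 + a * (p.1.1 - c * p.2).

(** This is [4 a t] times the derivative in [s] of the minimised function. *)
Definition slope p s : R :=
  b ^+ 2 * p.2 - offset p ^+ 2 * p.2 / clock p s ^+ 2 + 2 * a * (p.1.2 + s).

Definition kkt p s : Prop := [/\ 0 <= s, 0 <= slope p s & s * slope p s = 0].

Lemma clock_gt0 p s : 0 < p.2 -> 0 <= s -> 0 < clock p s.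
Proof. by move=> t0 s0; rewrite ltr_pwDl// mulr_ge0// ltW. Qed.

(** Strict convexity in quantitative form: the gap above the tangent at [s0] is
    an explicit positive multiple of [(s - s0)^2]. *)
Lemma Phi_sub_tangent p s s0 : 0 < p.2 -> 0 <= s -> 0 <= s0 ->
  Phi a b c p.1 p.2 s - Phi a b c p.1 p.2 s0 =
  slope p s0 * (s - s0) / (4 * a * p.2) + (s - s0) ^+ 2 *
    ((4 * p.2)^-1 + offset p ^+ 2 / (4 * clock p s * clock p s0 ^+ 2)).
Proof.
move=> t0 s0' s00.
have u0 := lt0r_neq0 (clock_gt0 t0 s0').
have u00 := lt0r_neq0 (clock_gt0 t0 s00).
have a0 := lt0r_neq0 a_gt0; have t0' := lt0r_neq0 t0.
rewrite /Phi /slope /offset /clock in u0 u00 *; field.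
by rewrite u0 u00 a0 t0'.
Qed.

(** Divided differences of [slope] between the points [p] and [q] and between
    the parameters [s] and [s']; on the diagonal they are the partial
    derivatives of [slope]. *)
Definition slope_ds p q s s' : R :=
  2 * a + a * offset p ^+ 2 * p.2 *
    (clock p s + clock q s') / (clock p s ^+ 2 * clock q s' ^+ 2).

Definition slope_dp p q s s' : R * R * R :=
  (- (a * (offset p + offset q) * q.2 / clock q s' ^+ 2), 2 * a,
   b ^+ 2 - (b - a * c) * (offset p + offset q) * q.2 / clock q s' ^+ 2
     - offset p ^+ 2 / clock q s' ^+ 2
     + offset p ^+ 2 * p.2 * (clock p s + clock q s') /
         (clock p s ^+ 2 * clock q s' ^+ 2)).

Lemma slope_increment p q s s' : 0 < p.2 -> 0 < q.2 -> 0 <= s -> 0 <= s' ->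
  slope q s' - slope p s =
  dot (slope_dp p q s s') (q - p) + (s' - s) * slope_ds p q s s'.
Proof.
move=> tp tq s0 s'0.
have u0 := lt0r_neq0 (clock_gt0 tp s0).
have u'0 := lt0r_neq0 (clock_gt0 tq s'0).
rewrite /dot /slope_dp /slope_ds /slope /offset /clock /= in u0 u'0 *; field.
by rewrite u0 u'0.
Qed.

Lemma slope_ds_gt0 p q s s' : 0 < p.2 -> 0 < q.2 -> 0 <= s -> 0 <= s' ->
  0 < slope_ds p q s s'.
Proof.
move=> tp tq s0 s'0; have u0 := clock_gt0 tp s0; have u'0 := clock_gt0 tq s'0.
apply: ltr_pwDl; first by rewrite mulr_gt0.
apply: divr_ge0; last by rewrite mulr_ge0 ?sqr_ge0.
apply: mulr_ge0; last exact/ltW/addr_gt0.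
by apply: mulr_ge0 (ltW tp); apply: mulr_ge0 (ltW a_gt0) (sqr_ge0 _).
Qed.

Lemma slope_lt p s s' : 0 < p.2 -> 0 <= s -> s < s' -> slope p s < slope p s'.
Proof.
move=> t0 s0 ss'; have s'0 := ltW (le_lt_trans s0 ss').
rewrite -subr_gt0 slope_increment// subrr linear0 add0r.
by rewrite mulr_gt0 ?subr_gt0 ?slope_ds_gt0.
Qed.

Lemma slope_continuous p s : 0 < p.2 -> 0 <= s -> {for s, continuous (slope p)}.
Proof.
move=> t0 s0; have u0 := lt0r_neq0 (clock_gt0 t0 s0).
have cu : {for s, continuous (clock p)}.
  by apply: continuousD; [exact: cst_continuous|exact: mulrl_continuous].
apply: (@continuousD _ _ _
    (fun s => b ^+ 2 * p.2 - offset p ^+ 2 * p.2 / clock p s ^+ 2)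
    (fun s => 2 * a * (p.1.2 + s))); last first.
  apply: cvgMr; apply: cvgD; [exact: cvg_cst|exact: cvg_id].
apply: cvgD; first exact: cvg_cst.
apply: cvgN; apply: cvgMr; apply: cvgV; first by rewrite expf_neq0.
exact: (cvgM cu cu).
Qed.

(** If [slope] is negative at [0], it vanishes somewhere: as [u >= t], it is at
    least [2 a (y + s) - m^2 / t], which is nonnegative at
    [s = m^2 / (2 a t) + |y|]. *)
Lemma kkt_exists p : 0 < p.2 -> exists s, kkt p s.
Proof.
move=> t0; have [g0|g0] := leP 0 (slope p 0).
  by exists 0; split; rewrite ?mul0r.
set T := offset p ^+ 2 / (2 * a * p.2) + `|p.1.2|.
have T0 : 0 <= T.
  by rewrite addr_ge0// divr_ge0 ?sqr_ge0// ltW// !mulr_gt0.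
have gT : 0 <= slope p T.
  have le_off : offset p ^+ 2 * p.2 / clock p T ^+ 2 <= offset p ^+ 2 / p.2.
    rewrite ler_pdivrMr ?exprn_gt0 ?clock_gt0//.
    rewrite [leRHS]mulrAC ler_pdivlMr// -mulrA -expr2 ler_wpM2l ?sqr_ge0//.
    rewrite lerXn2r ?nnegrE//; [exact: ltW|exact/ltW/clock_gt0|].
    by rewrite /clock lerDl mulr_ge0// ltW.
  have -> : slope p T = b ^+ 2 * p.2 + 2 * a * (p.1.2 + `|p.1.2|) +
      (offset p ^+ 2 / p.2 - offset p ^+ 2 * p.2 / clock p T ^+ 2).
    have a0 := lt0r_neq0 a_gt0; have t0' := lt0r_neq0 t0.
    have u0 := lt0r_neq0 (clock_gt0 t0 T0).
    by rewrite /slope {2}/T; field; rewrite a0 t0' u0.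
  have yT : 0 <= p.1.2 + `|p.1.2|.
    by have := ler_norm (- p.1.2); rewrite normrN; lra.
  apply: addr_ge0; last by rewrite subr_ge0.
  apply: addr_ge0; first by rewrite mulr_ge0 ?sqr_ge0// ltW.
  by apply: mulr_ge0 yT; rewrite mulr_ge0// ltW.
have [||s sT gs] := @IVT R (slope p) 0 T 0 T0.
  - by apply: continuous_in_subspaceT => s; rewrite inE/= in_itv/= => /andP[s0 _];
    exact: slope_continuous.
  - by rewrite ge_min le_max gT (ltW g0) orbT.
exists s; split; rewrite ?gs ?mulr0//.
by move: sT; rewrite in_itv/= => /andP[].
Qed.

Lemma kkt_lt_Phi p s s0 : 0 < p.2 -> kkt p s0 -> 0 <= s -> s != s0 ->
  Phi a b c p.1 p.2 s0 < Phi a b c p.1 p.2 s.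
Proof.
move=> t0 [s00 g0 sg0] s0' ss0; rewrite -subr_gt0 Phi_sub_tangent//.
rewrite ltr_wpDl//.
  rewrite mulrBr [slope p s0 * s0]mulrC sg0 subr0.
  by rewrite divr_ge0 ?mulr_ge0// ltW// !mulr_gt0.
rewrite mulr_gt0//; first by rewrite exprn_even_gt0//= subr_eq0.
rewrite ltr_pwDl ?invr_gt0 ?mulr_gt0// divr_ge0 ?sqr_ge0//.
by rewrite ltW// !mulr_gt0 ?exprn_gt0 ?clock_gt0.
Qed.

Lemma kkt_le_Phi p s s0 : 0 < p.2 -> kkt p s0 -> 0 <= s ->
  Phi a b c p.1 p.2 s0 <= Phi a b c p.1 p.2 s.
Proof.
move=> t0 k0 s0'; have [->//|ss0] := eqVneq s s0.
exact: ltW (kkt_lt_Phi t0 k0 s0' ss0).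
Qed.

Lemma phistar_kkt p s0 : 0 < p.2 -> kkt p s0 ->
  phistar a b c p.1 p.2 = Phi a b c p.1 p.2 s0.
Proof.
move=> t0 k0; have [s00 _ _] := k0; apply/eqP; rewrite eq_le; apply/andP; split.
  apply: ge_inf; last by exists s0.
  by exists (Phi a b c p.1 p.2 s0) => _ [s s0' <-]; exact: kkt_le_Phi.
apply: lb_le_inf; first by exists (Phi a b c p.1 p.2 s0), s0.
by move=> _ [s s0' <-]; exact: kkt_le_Phi.
Qed.

Lemma is_sstarP p s : 0 < p.2 -> is_sstar a b c p.1 p.2 s <-> kkt p s.
Proof.
move=> t0; split; last by move=> k; split; [case: k|exact: phistar_kkt].
have [s0 k0] := kkt_exists t0; rewrite /is_sstar (phistar_kkt t0 k0).
move=> [s0' Es]; have [->//|ss0] := eqVneq s s0.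
by have := kkt_lt_Phi t0 k0 s0' ss0; rewrite Es ltxx.
Qed.

Lemma kkt_unique p s s' : 0 < p.2 -> kkt p s -> kkt p s' -> s = s'.
Proof.
move=> t0 k k'; apply/eqP/negP => /negP ss'; have [s0 _ _] := k.
by have := lt_le_trans (kkt_lt_Phi t0 k' s0 ss') (kkt_le_Phi t0 k _);
   case: k' => s'0 _ _ /(_ _ s'0); rewrite ltxx.
Qed.

Local Notation phi := (fun p => phistar a b c p.1 p.2).
Local Notation sigma := (fun p => sstar a b c p.1 p.2).

Lemma kkt_sstar p : 0 < p.2 -> kkt p (sigma p).
Proof.
move=> t0; have [s0 k0] := kkt_exists t0; apply/is_sstarP => //.
by apply: (@xgetPex _ 0 [set s | is_sstar a b c p.1 p.2 s]); exists s0;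
  apply/is_sstarP.
Qed.

Lemma sstar_kkt p s : 0 < p.2 -> kkt p s -> sigma p = s.
Proof. by move=> t0; apply: kkt_unique => //; exact: kkt_sstar. Qed.

Lemma phistarE p : 0 < p.2 -> phi p = Phi a b c p.1 p.2 (sigma p).
Proof. by move=> t0; apply: phistar_kkt => //; exact: kkt_sstar. Qed.

Lemma sstar_ge0 p : 0 < p.2 -> 0 <= sigma p.
Proof. by move=> /kkt_sstar[]. Qed.

Lemma kkt0P p : kkt p 0 <-> 0 <= slope p 0.
Proof. by split=> [[]//|g0]; split; rewrite ?mul0r. Qed.

Lemma sstar_eq0 p : 0 < p.2 -> sigma p = 0 <-> 0 <= slope p 0.
Proof.
move=> t0; rewrite -kkt0P; split=> [<-|]; first exact: kkt_sstar.
exact: sstar_kkt.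
Qed.

Lemma slope_sstar p : 0 < p.2 -> slope p 0 < 0 -> slope p (sigma p) = 0.
Proof.
move=> t0 g0; have [s0 _ /eqP] := kkt_sstar t0; rewrite mulf_eq0 => /orP[|/eqP//].
by move=> /eqP/(sstar_eq0 t0); rewrite leNgt g0.
Qed.

Lemma lt_sstar p s : 0 < p.2 -> 0 <= s -> slope p s < 0 -> s < sigma p.
Proof.
move=> t0 s0 gs; have [s'0 g0 _] := kkt_sstar t0; rewrite ltNge; apply/negP.
rewrite le_eqVlt => /orP[/eqP E|ls]; first by move: gs; rewrite -E ltNge g0.
by have := slope_lt t0 s'0 ls => /(le_lt_trans g0)/lt_trans/(_ gs); rewrite ltxx.
Qed.

Lemma sstar_lt p s : 0 < p.2 -> 0 < s -> 0 < slope p s -> sigma p < s.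
Proof.
move=> t0 sp gs; have s0 := ltW sp; have [s'0 g0 /eqP] := kkt_sstar t0.
rewrite ltNge mulf_eq0 => /orP[/eqP ->|/eqP g]; first by rewrite -ltNge.
apply/negP; rewrite le_eqVlt => /orP[/eqP E|ls]; first by move: gs; rewrite E g ltxx.
by have := slope_lt t0 s0 ls; rewrite g => /(lt_trans gs); rewrite ltxx.
Qed.

(** * Regularity *)

Local Notation positive_time := [set p : R * R * R | 0 < p.2].

Lemma open_positive_time : open positive_time.
Proof.
by apply: (@open_comp _ _ (fun p : R * R * R => p.2) [set t | 0 < t]);
  [move=> p _; exact: cvg_snd|exact: open_gt].
Qed.

(** Divided differences in space-time, for a fixed parameter, of the minimised
    function; [n p] is the base of its first square. *)
Definition Phi_dp p q s : R * R * R :=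
  let n p := - p.1.1 + b * s + c * p.2 in
  (- ((n p + n q) / (4 * clock q s)), (p.1.2 + q.1.2 + 2 * s) / (4 * q.2),
   c * (n p + n q) / (4 * clock q s) - n p ^+ 2 / (4 * clock p s * clock q s)
   - (p.1.2 + s) ^+ 2 / (4 * p.2 * q.2)).

Lemma Phi_increment p q s : 0 < p.2 -> 0 < q.2 -> 0 <= s ->
  Phi a b c q.1 q.2 s - Phi a b c p.1 p.2 s = dot (Phi_dp p q s) (q - p).
Proof.
move=> tp tq s0.
have u0 := lt0r_neq0 (clock_gt0 tp s0).
have u'0 := lt0r_neq0 (clock_gt0 tq s0).
have t0 := lt0r_neq0 tp; have t'0 := lt0r_neq0 tq.
rewrite /dot /Phi_dp /Phi /clock /= in u0 u'0 *; field.
by rewrite u0 u'0 t0 t'0.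
Qed.

(** In this section the point of space-time [r] and the parameter [s] are
    functions of a variable point: [r] is the identity when a gradient formula
    is differentiated, and a constant when one end of an increment is kept
    fixed. *)
Section Regular.
Variables (k : nat) (U : set (R * R * R)) (r : R * R * R -> R * R * R).
Variable s : R * R * R -> R.
Hypotheses (oU : open U) (r_t : forall p, U p -> 0 < (r p).2).
Hypotheses (s_ge0 : forall p, U p -> 0 <= s p).
Hypotheses (Cr : Ck3 k U r) (Cs : Ck k U s).

Lemma clock_neq0 p : U p -> clock (r p) (s p) != 0.
Proof. by move=> Up; rewrite lt0r_neq0// clock_gt0 ?r_t ?s_ge0. Qed.

Lemma Ck_clock : Ck k U (fun p => clock (r p) (s p)).
Proof. by have [C1 C2 C3] := Cr; rewrite /clock; Ck_tac. Qed.

Lemma Ck_offset : Ck k U (fun p => offset (r p)).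
Proof. by have [C1 C2 C3] := Cr; rewrite /offset; Ck_tac. Qed.

Lemma Ck_slope : Ck k U (fun p => slope (r p) (s p)).
Proof.
have [C1 C2 C3] := Cr; have Cu := Ck_clock; have Cm := Ck_offset.
by rewrite /slope; Ck_tac => p Up; rewrite expf_neq0 ?clock_neq0.
Qed.

Lemma Ck_Phi : Ck k U (fun p => Phi a b c (r p).1 (r p).2 (s p)).
Proof.
have [C1 C2 C3] := Cr; have Cu := Ck_clock.
rewrite /Phi; Ck_tac => p Up; rewrite mulf_neq0 ?pnatr_eq0 ?clock_neq0//.
by rewrite lt0r_neq0// r_t.
Qed.

End Regular.

Section RegularIncrement.
Variables (k : nat) (U : set (R * R * R)) (r : R * R * R -> R * R * R).
Variables s s' : R * R * R -> R.
Hypotheses (oU : open U) (U_t : forall p, U p -> 0 < p.2).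
Hypotheses (r_t : forall p, U p -> 0 < (r p).2).
Hypotheses (s_ge0 : forall p, U p -> 0 <= s p).
Hypotheses (s'_ge0 : forall p, U p -> 0 <= s' p).
Hypotheses (Cr : Ck3 k U r) (Cs : Ck k U s) (Cs' : Ck k U s').

Lemma Ck_slope_ds : Ck k U (fun p => slope_ds (r p) p (s p) (s' p)).
Proof.
have [C1 C2 C3] := Cr; have Cm := Ck_offset oU Cr.
have Cu := Ck_clock oU Cr Cs; have Cu' := Ck_clock oU (Ck3_id k oU) Cs'.
rewrite /slope_ds; Ck_tac => p Up.
by rewrite mulf_neq0 ?expf_neq0 ?(clock_neq0 r_t s_ge0) ?(clock_neq0 U_t s'_ge0).
Qed.

Lemma Ck_slope_dp : Ck3 k U (fun p => slope_dp (r p) p (s p) (s' p)).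
Proof.
have [C1 C2 C3] := Cr; have Cm := Ck_offset oU Cr.
have Cm' := Ck_offset oU (Ck3_id k oU).
have Cu := Ck_clock oU Cr Cs; have Cu' := Ck_clock oU (Ck3_id k oU) Cs'.
by split; rewrite /slope_dp /=; Ck_tac => p Up; rewrite ?mulf_neq0 ?expf_neq0
  ?(clock_neq0 r_t s_ge0) ?(clock_neq0 U_t s'_ge0).
Qed.

Lemma Ck_Phi_dp : Ck3 k U (fun p => Phi_dp (r p) p (s p)).
Proof.
have [C1 C2 C3] := Cr.
have Cu := Ck_clock oU Cr Cs; have Cu' := Ck_clock oU (Ck3_id k oU) Cs.
have rt p : U p -> (r p).2 != 0 by move=> Up; rewrite lt0r_neq0 ?r_t.
have Ut p : U p -> p.2 != 0 by move=> Up; rewrite lt0r_neq0 ?U_t.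
by split; rewrite /Phi_dp /=; Ck_tac => p Up; rewrite ?mulf_neq0 ?pnatr_eq0
  ?(clock_neq0 r_t s_ge0) ?(clock_neq0 U_t s_ge0) ?rt ?Ut.
Qed.

End RegularIncrement.

(** As [slope] increases in [s], its sign at a fixed [s] tells on which side of
    [s] the minimiser lies, and this sign persists at nearby points. *)
Lemma sstar_continuous : Ck 0 positive_time sigma.
Proof.
have oH := open_positive_time.
have nearH p : 0 < p.2 -> \forall q \near p, 0 < q.2.
  by move=> t0; exact: open_nbhs_nbhs (conj oH t0).
have c_slope s p : 0 < p.2 -> 0 <= s -> {for p, continuous (slope ^~ s)}.
  move=> t0 s0; have Cs := Ck_cst 0 s oH.
  exact: (Ck_slope (r := id) oH (fun _ => id) (fun _ _ => s0) (Ck3_id 0 oH) Cs p t0).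
move=> p t0; apply/cvgrPdist_lt => e e0.
have [s0 g0 _] := kkt_sstar t0.
have up : \forall q \near p, sigma q < sigma p + e.
  have se0 : 0 < sigma p + e by rewrite ltr_wpDl.
  have g : 0 < slope p (sigma p + e).
    by apply: le_lt_trans g0 _; rewrite slope_lt// ltrDl.
  near=> q; apply: sstar_lt => //; first by near: q; exact: nearH.
  by near: q; exact: (cvgr_gt _ (c_slope _ _ t0 (ltW se0)) _ g).
have lo : \forall q \near p, sigma p - e < sigma q.
  have [se|se] := ltP (sigma p) e.
    near=> q; apply: lt_le_trans (sstar_ge0 (_ : 0 < q.2)).
      by rewrite subr_lt0.
    by near: q; exact: nearH.
  have se0 : 0 <= sigma p - e by rewrite subr_ge0.
  have g : slope p (sigma p - e) < 0.
    have sp : sigma p != 0 by rewrite lt0r_neq0// (lt_le_trans e0).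
    have [_ _ /eqP] := kkt_sstar t0; rewrite mulf_eq0 (negbTE sp) => /eqP g.
    by rewrite -g slope_lt// ltrBlDr ltrDl.
  near=> q; apply: lt_sstar => //; first by near: q; exact: nearH.
  by near: q; exact: (cvgr_lt _ (c_slope _ _ t0 se0) _ g).
near=> q; rewrite ltr_norml.
have : sigma q < sigma p + e by near: q; exact: up.
have : sigma p - e < sigma q by near: q; exact: lo.
by move=> ? ?; apply/andP; split; lra.
Unshelve. all: by end_near. Qed.

(** The envelope theorem. *)
Lemma phistar_derive p : 0 < p.2 -> differentiable phi p /\
  forall v, 'D_v phi p = dot (Phi_dp p p (sigma p)) v.
Proof.
move=> tp; have s0 := sstar_ge0 tp; have oH := open_positive_time.
have cD (s : R * R * R -> R) : (forall q, 0 < q.2 -> 0 <= s q) ->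
    Ck 0 positive_time s -> {for p, continuous (fun q => Phi_dp p q (s q))}.
  move=> sge0 Cs; apply: (Ck3_continuous (U := positive_time) _ tp).
  exact: (Ck_Phi_dp (r := fun _ => p) oH (fun _ => id) (fun _ _ => tp) sge0
    (Ck3_cst 0 p oH) Cs).
(* Each bound freezes the parameter at the minimiser of one of the two points,
   which is admissible at the other. *)
apply: (squeeze_differentiable (cD _ sstar_ge0 sstar_continuous)
  (cD _ (fun _ _ => s0) (Ck_cst 0 (sigma p) oH))) => //.
near=> q.
have tq : 0 < q.2 by near: q; exact: open_nbhs_nbhs (conj oH tp).
have s'0 := sstar_ge0 tq.
rewrite -!Phi_increment// !phistarE// lerD2l lerN2 lerD2r.
by rewrite !kkt_le_Phi//; exact: kkt_sstar.
Unshelve. all: by end_near. Qed.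

Lemma phistar_C1 : Ck 1 positive_time phi.
Proof.
have oH := open_positive_time; split=> [p tp|v].
  by have [] := phistar_derive tp.
have CD := Ck_Phi_dp (r := id) oH (fun _ => id) (fun _ => id) sstar_ge0
  (Ck3_id 0 oH) sstar_continuous.
apply: Ck_eq oH _ (Ck_dot v oH CD) => p tp.
by have [_ ->] := phistar_derive tp.
Qed.

(** The region where the minimiser is positive, without the constraint
    [y >= 0], so that it is open. *)
Local Notation positive_min := [set p : R * R * R | 0 < p.2 /\ slope p 0 < 0].

Lemma open_positive_min : open positive_min.
Proof.
have oH := open_positive_time; have C0 := Ck_cst 0 (0 : R) oH.
have cg := Ck_slope (r := id) oH (fun _ => id) (fun _ _ => lexx 0)
  (Ck3_id 0 oH) C0.
rewrite openE => p [tp gp]; near=> q; split.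
  by near: q; exact: open_nbhs_nbhs (conj oH tp).
by near: q; exact: (cvgr_lt _ (cg p tp) _ gp).
Unshelve. all: by end_near. Qed.

(** The two values of [slope] at the minimisers vanish, so their difference
    gives a linear equation for the increment of the minimiser. *)
Lemma sstar_increment p q : positive_min p -> positive_min q ->
  sigma q - sigma p = dot (- (slope_ds p q (sigma p) (sigma q))^-1 *:
    slope_dp p q (sigma p) (sigma q)) (q - p).
Proof.
move=> [tp gp] [tq gq]; have s0 := sstar_ge0 tp; have s'0 := sstar_ge0 tq.
have := slope_increment tp tq s0 s'0.
rewrite !slope_sstar// subrr => /esym/eqP; rewrite addr_eq0 => /eqP E.
have d0 := lt0r_neq0 (slope_ds_gt0 tp tq s0 s'0).
by rewrite dotZl E mulrNN mulrC mulfK.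
Qed.

Lemma sstar_derive p : positive_min p -> differentiable sigma p /\
  forall v, 'D_v sigma p = dot (- (slope_ds p p (sigma p) (sigma p))^-1 *:
    slope_dp p p (sigma p) (sigma p)) v.
Proof.
move=> Mp; have [tp _] := Mp; have oH := open_positive_time.
have Cs := sstar_continuous; have Csp := Ck_cst 0 (sigma p) oH.
have sp_ge0 q (_ : 0 < q.2) := sstar_ge0 tp.
have cL := Ck3_continuous (Ck_slope_dp (r := fun _ => p) oH (fun _ => id)
  (fun _ _ => tp) sp_ge0 sstar_ge0 (Ck3_cst 0 p oH) Csp Cs) tp.
have cd := Ck_slope_ds (r := fun _ => p) oH (fun _ => id) (fun _ _ => tp)
  sp_ge0 sstar_ge0 (Ck3_cst 0 p oH) Csp Cs p tp.
have cA : {for p, continuous (fun q => - (slope_ds p q (sigma p) (sigma q))^-1 *: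
    slope_dp p q (sigma p) (sigma q))}.
  apply: cvgZ cL; apply: cvgN; apply: cvgV cd.
  by rewrite lt0r_neq0 ?slope_ds_gt0 ?sstar_ge0.
apply: (squeeze_differentiable cA cA) => //.
near=> q.
have Mq : positive_min q by near: q; exact: open_nbhs_nbhs (conj open_positive_min Mp).
by rewrite sstar_increment// lexx.
Unshelve. all: by end_near. Qed.

(** The bootstrap: the derivatives of the minimiser are rational functions of
    the point and of the minimiser, so they are as regular as the minimiser. *)
Lemma sstar_smooth k : Ck k positive_min sigma.
Proof.
have oM := open_positive_min.
elim: k => [|k IH].
  by move=> p [tp _]; exact: sstar_continuous.
split=> [p Mp|v]; first by have [] := sstar_derive Mp.
have MH p : positive_min p -> 0 < p.2 by case.
have s0 p : positive_min p -> 0 <= sigma p by case=> tp _; exact: sstar_ge0.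
have CL := Ck_dot v oM (Ck_slope_dp (r := id) oM MH MH s0 s0 (Ck3_id k oM) IH IH).
have Cd := Ck_slope_ds (r := id) oM MH MH s0 s0 (Ck3_id k oM) IH IH.
have CV : Ck k positive_min (fun p => - (slope_ds p p (sigma p) (sigma p))^-1).
  apply: Ck_opp => //; apply: Ck_inv => // q Mq.
  by rewrite lt0r_neq0 ?slope_ds_gt0 ?s0 ?MH.
apply: Ck_eq (Ck_mul oM CV CL) => // p Mp.
by have [_ ->] := sstar_derive Mp; rewrite dotZl.
Qed.

Lemma phistar_smooth_positive_min : Cinfty positive_min phi.
Proof.
move=> k; have oM := open_positive_min.
apply: (@Ck_eq _ _ positive_min (fun p => Phi a b c p.1 p.2 (sigma p))) => //.
  by move=> p [tp _]; rewrite phistarE.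
have s0 p : positive_min p -> 0 <= sigma p by case=> tp _; exact: sstar_ge0.
by apply: (Ck_Phi (r := id)) (Ck3_id k oM) (sstar_smooth k) => // p [].
Qed.

Lemma Phi0_smooth : Cinfty positive_time (fun p => Phi a b c p.1 p.2 0).
Proof.
move=> k; have oH := open_positive_time.
exact: (Ck_Phi (r := id) oH (fun _ => id) (fun _ _ => lexx 0) (Ck3_id k oH)
  (Ck_cst k 0 oH)).
Qed.

(** * The two regions, the equation and homogeneity *)

Lemma region_S0P p : region_S0 a b c p <-> 0 <= p.1.2 /\ 0 < p.2 /\ 0 <= slope p 0.
Proof.
rewrite /region_S0 /space_time /closed_half_plane /Rplus; case: p => [[x y] t] /=.
have sE : 0 < t -> slope (x, y, t) 0 =
    2 * a * (y - (a / (2 * t) * (x - c * t) ^+ 2 + b * (x - c * t))).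
  move=> t0; have t0' := lt0r_neq0 t0.
  by rewrite /slope /clock /offset /=; field; rewrite t0'.
split=> [[[y0 t0]] h|[y0 [t0]]].
  by rewrite sE// pmulr_rge0 ?subr_ge0// mulr_gt0.
by rewrite sE// pmulr_rge0 ?subr_ge0 ?mulr_gt0.
Qed.

Lemma region_SP p : region_S a b c p <-> 0 <= p.1.2 /\ positive_min p.
Proof.
rewrite /region_S; split=> [[[y0 t0] nS]|[y0 [t0 g]]].
  by do 2?split=> //; rewrite ltNge; apply/negP => g; apply: nS; apply/region_S0P.
by split=> // /region_S0P[_ [_]]; rewrite leNgt g.
Qed.

Lemma sstar_cubic p : positive_min p ->
  2 * (p.1.2 + sigma p) * (p.2 + a * sigma p) ^+ 2
  = a * p.1.1 ^+ 2 * p.2 - 2 * (a * c - b) * p.1.1 * p.2 ^+ 2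
    + c * (a * c - 2 * b) * p.2 ^+ 3
    - b ^+ 2 * p.2 * sigma p * (2 * p.2 + a * sigma p).
Proof.
move=> [tp gp]; have g := slope_sstar tp gp.
have u0 := lt0r_neq0 (clock_gt0 tp (sstar_ge0 tp)).
apply/eqP; rewrite -subr_eq0; apply/eqP.
(* The difference of the two sides is [slope] times [u^2 / a]. *)
rewrite -[RHS](mulr0 (clock p (sigma p) ^+ 2 / a)) -g.
have a0 := lt0r_neq0 a_gt0.
rewrite /slope /clock /offset in u0 *; field.
by rewrite u0 a0.
Qed.

Lemma kkt_scale (x : R * R) t s : 0 < t -> kkt (x, 1) s ->
  kkt (t *: x, t) (t * s).
Proof.
move=> t0 [s0 g0 sg0].
have gE : slope (t *: x, t) (t * s) = t * slope (x, 1) s.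
  have u0 := lt0r_neq0 (@clock_gt0 (x, 1) s ltr01 s0).
  have u'0 := lt0r_neq0 (@clock_gt0 (t *: x, t) (t * s) t0 (mulr_ge0 (ltW t0) s0)).
  rewrite /slope /clock /offset /= /GRing.scale /= in u0 u'0 *; field.
  by rewrite u0 u'0.
split; rewrite ?gE ?mulr_ge0 ?(ltW t0)//.
by rewrite mulrACA sg0 mulr0.
Qed.

Lemma Phi_scale (x : R * R) t s : 0 < t -> 0 <= s ->
  Phi a b c (t *: x) t (t * s) = t * Phi a b c x 1 s.
Proof.
move=> t0 s0; have t0' := lt0r_neq0 t0.
have u0 := lt0r_neq0 (@clock_gt0 (x, 1) s ltr01 s0).
have u'0 := lt0r_neq0 (@clock_gt0 (t *: x, t) (t * s) t0 (mulr_ge0 (ltW t0) s0)).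
rewrite /Phi /clock /= /GRing.scale /= in u0 u'0 *; field.
by rewrite u0 u'0 t0'.
Qed.

Lemma sstar_scale (x : R * R) t : 0 < t ->
  sstar a b c (t *: x) t = t * sstar a b c x 1.
Proof.
move=> t0; apply: (@sstar_kkt (t *: x, t)) => //.
by apply: kkt_scale => //; exact: (@kkt_sstar (x, 1) ltr01).
Qed.

Lemma phistar_scale (x : R * R) t : 0 < t ->
  phistar a b c (t *: x) t = t * phistar a b c x 1.
Proof.
move=> t0; rewrite (@phistarE (t *: x, t))// (@phistarE (x, 1))//=.
by rewrite sstar_scale// Phi_scale// (@sstar_ge0 (x, 1)).
Qed.

End Minimizer.

Theorem proposition2 (R : realType) (a b c : R)
    (ha : 0 < a) (hb : 0 < b) (hc : 0 < c) :
  [/\ (* existence and uniqueness *)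
      forall (x : R * R) (t : R), space_time (x, t) ->
        exists! s : R, is_sstar a b c x t s,
      (* 1; the term in b ^+ 2 is absent from the printed equation, which is false
         without it: see NOTES.md *)
      (forall (x : R * R) (t : R), space_time (x, t) ->
         (sstar a b c x t = 0 <-> region_S0 a b c (x, t))) /\
      (forall (x : R * R) (t : R), region_S a b c (x, t) ->
         2 * (x.2 + sstar a b c x t) * (t + a * sstar a b c x t) ^+ 2
         = a * x.1 ^+ 2 * t - 2 * (a * c - b) * x.1 * t ^+ 2
           + c * (a * c - 2 * b) * t ^+ 3
           - b ^+ 2 * t * sstar a b c x t * (2 * t + a * sstar a b c x t)),
      (* 2 *)
      [/\ Cinfty_on (region_S0 a b c) (fun p => phistar a b c p.1 p.2),
          Cinfty_on (region_S a b c) (fun p => phistar a b c p.1 p.2)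
        & Ck_on 1 space_time (fun p => phistar a b c p.1 p.2)]
    & (* 3 *)
      forall (x : R * R) (t : R), space_time (x, t) ->
        phistar a b c (t *: x) t = t * phistar a b c x 1 /\
        sstar a b c (t *: x) t = t * sstar a b c x 1].
Proof.
split.
- move=> x t [_ t0]; exists (sstar a b c x t).
  have k := @kkt_sstar R a b c ha (x, t) t0.
  split; first exact/(@is_sstarP R a b c ha (x, t) _ t0).
  move=> s /(@is_sstarP R a b c ha (x, t) s t0) ks.
  exact: kkt_unique t0 k ks.
- split=> [x t [y0 t0]|x t /(region_SP b c ha)[_ M]].
    have := @sstar_eq0 R a b c ha (x, t) t0; rewrite /= => ->; split=> [g|].
      by apply/region_S0P.
    by move=> /(region_S0P b c ha)[_ [_]].
  exact: (sstar_cubic ha M).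
- split=> p.
  + move=> /(region_S0P b c ha)[_ [tp _]].
    exists [set p | 0 < p.2], (fun p => Phi a b c p.1 p.2 0); split=> //.
    * exact: open_positive_time.
    * exact: Phi0_smooth.
    move=> q tq /(region_S0P b c ha)[_ [_ g]].
    by rewrite (phistarE b c ha tq) ((sstar_eq0 b c ha tq).2 g).
  + move=> /(region_SP b c ha)[_ M].
    exists [set p | 0 < p.2 /\ slope a b c p 0 < 0], (fun p => phistar a b c p.1 p.2).
    by split=> //; [exact: open_positive_min|exact: phistar_smooth_positive_min].
  move=> [_ tp]; exists [set p | 0 < p.2], (fun p => phistar a b c p.1 p.2).
  by split=> //; [exact: open_positive_time|exact: phistar_C1].
- by move=> x t [_ t0]; split; [exact: phistar_scale|exact: sstar_scale].
Qed.
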